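(* Let $X$ be a locale, $(Y,J)$ a modal space and $f:X\to Y$ a continuous surjection such that $f^{-1}:Y\to X$ has a left adjoint. Then there exists $I:X\to X$ such that $(X,I)$ is a modal space and, for all $a,b\in Y$, $$f^{-1}(a\rightarrow_J b)=f^{-1}(a)\rightarrow_I f^{-1}(b).$$
   Context: A locale $X$ is identified with its frame: a complete lattice in which finite meets distribute over arbitrary joins. A modal space is a pair $(X,J)$ where $X$ is a locale and $J:X\to X$ is a monotone function preserving all joins. For a modal space $(X,J)$ and $a,b\in X$ put $a\rightarrow_J b=\bigvee\{d\in X : Jd\wedge a\le b\}$. A continuous map $f:X\to Y$ of locales is given by a map $f^{-1}:Y\to X$ preserving arbitrary joins and finite meets; $f$ is a surjection if $f^{-1}$ is injective. A left adjoint of $f^{-1}$ is a monotone map $f_!:X\to Y$ with $f_!(x)\le y\iff x\le f^{-1}(y)$. *)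

(* Defs.v *)
From HB Require Import structures.
From mathcomp Require Import all_boot all_order.
From mathcomp Require Import classical_sets.

Set Implicit Arguments.
Unset Strict Implicit.
Unset Printing Implicit Defensive.

Import Order.TTheory.
Local Open Scope classical_set_scope.
Local Open Scope order_scope.

HB.mixin Record TBLattice_isCompleteLattice (d : Order.disp_t) T
    of Order.TBLattice d T := {
  bigvee : set T -> T;
  bigvee_isLub : forall A : set T, isLub A (bigvee A)
}.

#[short(type="completeLatticeType")]
HB.structure Definition CompleteLattice (d : Order.disp_t) :=
  { T of Order.TBLattice d T & TBLattice_isCompleteLattice d T }.

HB.mixin Record CompleteLattice_isFrame (d : Order.disp_t) T
    of CompleteLattice d T := {
  meet_bigvee : forall (x : T) (A : set T),
    x `&` bigvee A = bigvee [set x `&` a | a in A]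
}.

(* A locale is represented by its frame; continuous maps go the other way
   (see [locale_map]). *)
#[short(type="frameType")]
HB.structure Definition Frame (d : Order.disp_t) :=
  { T of CompleteLattice d T & CompleteLattice_isFrame d T }.

Definition preserves_joins (d d' : Order.disp_t)
    (X : completeLatticeType d) (Y : completeLatticeType d') (g : X -> Y) :
    Prop :=
  forall A : set X, g (bigvee A) = bigvee (g @` A).

Definition modal_space (d : Order.disp_t) (X : frameType d) (J : X -> X) :
    Prop :=
  {homo J : x y / x <= y} /\ preserves_joins J.

Definition modal_imp (d : Order.disp_t) (X : frameType d) (J : X -> X)
    (a b : X) : X :=
  bigvee [set e : X | J e `&` a <= b].

(* [inv_image f] is the map written f^{-1}; preservation of finite meets is
   split into the empty and the binary meet. *)
Record locale_map (d d' : Order.disp_t) (X : frameType d) (Y : frameType d') :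
    Type := LocaleMap {
  inv_image : Y -> X;
  inv_image_joins : preserves_joins inv_image;
  inv_image_top : inv_image \top = \top;
  inv_image_meet : Order.meet_morphism inv_image
}.

Definition locale_surjection (d d' : Order.disp_t) (X : frameType d)
    (Y : frameType d') (f : locale_map X Y) : Prop :=
  injective (inv_image f).

Definition left_adjoint (d d' : Order.disp_t) (X : frameType d)
    (Y : frameType d') (l : X -> Y) (g : Y -> X) : Prop :=
  {homo l : x x' / x <= x'} /\
  forall (x : X) (y : Y), l x <= y <-> x <= g y.

(* Main.v *)
(* The modality on X is I = f^{-1} o J o f_!, which preserves joins because f_!
   is a left adjoint. As f is a surjection, f^{-1} reflects the order, so
   f^{-1} b is above I e /\ f^{-1} a exactly when b is above J (f_! e) /\ a; the
   unit and the identity f_! o f^{-1} = id then make the two families of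
   witnesses cofinal in one another. *)
Require Import Defs.
From mathcomp Require Import all_boot all_order.
From mathcomp Require Import classical_sets.

Set Implicit Arguments.
Unset Strict Implicit.
Unset Printing Implicit Defensive.

Import Order.TTheory.
Local Open Scope classical_set_scope.
Local Open Scope order_scope.

Section BigVee.
Context (d : Order.disp_t) (X : completeLatticeType d).
Implicit Types (A B : set X) (x : X).

Lemma bigvee_ub A x : A x -> x <= bigvee A.
Proof. by have [ubA _] := bigvee_isLub A; apply: ubA. Qed.

Lemma bigvee_le A x : (forall y, A y -> y <= x) -> bigvee A <= x.
Proof. by have [_ lbA] := bigvee_isLub A; apply: lbA. Qed.

Lemma bigvee_cofinal A B :
  (forall x, A x -> exists2 y, B y & x <= y) -> bigvee A <= bigvee B.
Proof.
move=> AB; apply: bigvee_le => x /AB [y By xy].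
exact: le_trans xy (bigvee_ub By).
Qed.

End BigVee.

Section Adjunction.
Context (d d' : Order.disp_t) (X : frameType d) (Y : frameType d').
Context (l : X -> Y) (g : Y -> X) (lg : left_adjoint l g).

Lemma left_adjoint_unit x : x <= g (l x).
Proof. by apply/lg.2. Qed.

Lemma left_adjoint_counit y : l (g y) <= y.
Proof. by apply/lg.2. Qed.

(** Transposing along the adjunction moves the bound on [l (bigvee A)] to [bigvee A], where it is
    checked on each member of [A] and transposed back; the converse is monotonicity of [l]. *)
Lemma left_adjoint_joins : preserves_joins l.
Proof.
move=> A; apply: le_anti; apply/andP; split.
  apply/lg.2; apply: bigvee_le => x Ax; apply/lg.2.
  by apply: bigvee_ub; exists x.
by apply: bigvee_le => _ [x Ax <-]; apply/lg.1/bigvee_ub.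
Qed.

(** Unit and counit give the triangle identity [g (l (g y)) = g y]; injectivity cancels the outer
    [g]. *)
Lemma left_adjointK : {homo g : x y / x <= y} -> injective g -> cancel g l.
Proof.
move=> g_homo g_inj y; apply/g_inj/le_anti/andP; split.
  exact/g_homo/left_adjoint_counit.
exact: left_adjoint_unit.
Qed.

End Adjunction.

Lemma meet_morphism_homo (d d' : Order.disp_t) (Y : latticeType d)
    (X : latticeType d') (g : Y -> X) :
  Order.meet_morphism g -> {homo g : x y / x <= y}.
Proof. by move=> gI x y /meet_idPl xy; apply/meet_idPl; rewrite -gI xy. Qed.

(** The order is equational, [x <= y] being [x]&[y = x], and an injective meet morphism preserves
    and reflects this equation. *)
Lemma meet_morphism_inj_mono (d d' : Order.disp_t) (Y : latticeType d)
    (X : latticeType d') (g : Y -> X) :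
  Order.meet_morphism g -> injective g -> {mono g : x y / x <= y}.
Proof. by move=> gI g_inj x y; rewrite !leEmeet -gI (inj_eq g_inj). Qed.

Lemma preserves_joins_comp (d1 d2 d3 : Order.disp_t)
    (X : completeLatticeType d1) (Y : completeLatticeType d2)
    (Z : completeLatticeType d3) (g : Y -> Z) (h : X -> Y) :
  preserves_joins g -> preserves_joins h -> preserves_joins (g \o h).
Proof. by move=> gJ hJ A; rewrite /= hJ gJ image_comp. Qed.

Theorem theorem3p7 (d d' : Order.disp_t) (X : frameType d) (Y : frameType d')
    (J : Y -> Y) (hJ : modal_space J) (f : locale_map X Y)
    (hf : locale_surjection f)
    (hadj : exists l : X -> Y, left_adjoint l (inv_image f)) :
  exists I : X -> X,
    modal_space I /\
    forall a b : Y,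
      inv_image f (modal_imp J a b)
      = modal_imp I (inv_image f a) (inv_image f b).
Proof.
case: hadj => l lg; case: hJ => J_homo J_joins.
have gI := @inv_image_meet _ _ _ _ f.
have g_joins := @inv_image_joins _ _ _ _ f.
set g := inv_image f in lg gI g_joins *.
have g_homo := meet_morphism_homo gI.
have g_mono := meet_morphism_inj_mono gI hf.
have gK := left_adjointK lg g_homo hf.
exists (g \o (J \o l)); split.
  split; first by move=> x y xy /=; apply/g_homo/J_homo/lg.1.
  apply: preserves_joins_comp => //; apply: preserves_joins_comp => //.
  exact: left_adjoint_joins lg.
(* With [g] moved inside the join, both sides are joins in [X]. *)
move=> a b; rewrite /modal_imp g_joins.
apply: le_anti; apply/andP; split; apply: bigvee_cofinal.
  (* [g e] is its own witness, since [J (l (g e))] is [J e]. *)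
  move=> _ [e /= Je <-]; exists (g e) => //=.
  by rewrite gK -gI g_mono.
(* Here [e] may lie outside the image of [g]; it is replaced by the larger [g (l e)], and [Je] says
   that [l e] belongs to the family for [J]. *)
move=> e /=; rewrite -gI g_mono => Je.
by exists (g (l e)); [exists (l e) | exact: left_adjoint_unit lg _].
Qed.
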